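(* Let $(e_n)_{n=1}^\infty$ be a $\sigma$-order basis for a $\sigma$-order continuous Banach lattice $X$. Then $(e_n)$ is also a Schauder basis for $X$ with the same biorthogonal functionals.
   Context: All Banach lattices are real. A Banach lattice $X$ is $\sigma$-order continuous if every decreasing sequence in $X$ with infimum $0$ converges to $0$ in norm. A sequence $(x_n)$ in a Banach lattice $X$ $\sigma$-order converges to $x$ if there is a sequence $(z_m)$ in $X$, decreasing with infimum $0$ in $X$, such that for every $m$, $|x_n-x|\le z_m$ for all but finitely many $n$. A sequence $(e_n)$ is a $\sigma$-order (respectively Schauder) basis for $X$ if for every $x\in X$ there is a unique $(a_n)\in\mathbb R^{\mathbb N}$ such that the partial sums $\sum_{n=1}^m a_ne_n$ $\sigma$-order converge (respectively converge in norm) to $x$; in each case the associated biorthogonal functionals are the maps $x\mapsto a_k$, $k\ge 1$. *)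

(* Defs.v *)
From HB Require Import structures.
From mathcomp Require Import all_boot all_order all_algebra.
From mathcomp Require Import all_classical all_reals all_analysis.

Set Implicit Arguments.
Unset Strict Implicit.
Unset Printing Implicit Defensive.

Import Order.TTheory GRing.Theory Num.Theory.
Import numFieldNormedType.Exports.

Local Open Scope classical_set_scope.
Local Open Scope ring_scope.

Reserved Notation "x <=v y" (at level 70, y at next level).

(* The order is a field of the mixin because Hierarchy Builder rejects a
   structure joining [CompleteNormedModule] with the [Order] hierarchy (the
   missing common ancestors would have to be declared before [Num.NumDomain]).
   The notation [`|x|] denotes the norm; the lattice absolute value is
   [vjoin x (- x)], called [vabs] below. *)
HB.mixin Record isBanachLattice (R : realType) (X : Type)
    of CompleteNormedModule R X := {
  vle : rel X ;
  vjoin : X -> X -> X ;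
  vmeet : X -> X -> X ;
  vle_refl : reflexive vle ;
  vle_anti : antisymmetric vle ;
  vle_trans : transitive vle ;
  vle_joinP : forall x y z : X, vle (vjoin x y) z = vle x z && vle y z ;
  vle_meetP : forall x y z : X, vle z (vmeet x y) = vle z x && vle z y ;
  vle_add2r : forall z x y : X, vle x y -> vle (x + z) (y + z) ;
  vle_scale : forall (a : R) (x y : X),
    0 <= a -> vle x y -> vle (a *: x) (a *: y) ;
  vle_norm : forall x y : X,
    vle (vjoin x (- x)) (vjoin y (- y)) -> `|x| <= `|y|
}.

#[short(type="banachLatticeType")]
HB.structure Definition BanachLattice (R : realType) :=
  { X of CompleteNormedModule R X & isBanachLattice R X }.

Notation "x <=v y" := (vle x y) : ring_scope.

Section BanachLatticeDefs.
Context {R : realType} {X : banachLatticeType R}.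
Implicit Types (u z e : nat -> X) (x : X).

Definition vabs x : X := vjoin x (- x).

Definition decreasing_to0 z : Prop :=
  [/\ forall m n, (m <= n)%N -> z n <=v z m,
      forall m, 0 <=v z m &
      forall w : X, (forall m, w <=v z m) -> w <=v 0].

Definition norm_cvg u x : Prop := u @ \oo --> x.

Definition sigma_order_cvg u x : Prop :=
  exists2 z, decreasing_to0 z &
    forall m, \forall n \near \oo, vabs (u n - x) <=v z m.

(* Sequences are indexed from 0, so [series (fun n => a n *: e n) m] is the
   sum of the first [m] terms, the case [m = 0] being the empty sum. *)
Definition expansion (cvg_to : (nat -> X) -> X -> Prop) e x (a : nat -> R) :
    Prop :=
  cvg_to (series (fun n => a n *: e n)) x.

Definition is_basis (cvg_to : (nat -> X) -> X -> Prop) e : Prop :=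
  forall x, exists! a : nat -> R, expansion cvg_to e x a.

(* [x |-> a_k] for the expansion [a] of [x]; meaningful only when [e] is a
   basis for [cvg_to], since [xget] otherwise may return any expansion or the
   default value 0. *)
Definition biorthogonal (cvg_to : (nat -> X) -> X -> Prop) e (k : nat) :
    X -> R :=
  fun x => xget (fun=> 0) [set a | expansion cvg_to e x a] k.

Definition sigma_order_basis e : Prop := is_basis sigma_order_cvg e.

Definition schauder_basis e : Prop := is_basis norm_cvg e.

End BanachLatticeDefs.

Definition sigma_order_continuous (R : realType) (X : banachLatticeType R) :
    Prop :=
  forall z : nat -> X, decreasing_to0 z -> norm_cvg z 0.

(* Main.v *)
Require Import Defs.
From mathcomp Require Import all_boot all_order all_algebra.
From mathcomp Require Import all_classical all_reals all_analysis.
From mathcomp Require Import ring lra.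

(* Under sigma-order continuity, u_n sigma-order converges to x iff for every
   eps > 0 there is z with |z| <= eps dominating |u_n - x| for all large n; in
   particular order expansions are norm expansions, and only uniqueness of
   norm expansions is at stake.  Order convergent sequences are order bounded,
   so every x admits a z dominating all partial sums of its expansion.  By
   Baire, some y |-> (u, z) with u approximating y within |y|/2 and |z| <= C |y|
   exists for all y; summing the successive approximations gives an order
   expansion of y whose partial sums are dominated by an element of norm at
   most 2 C |y|.  Hence the coordinate functionals are norm continuous. *)

Set Implicit Arguments.
Unset Strict Implicit.
Unset Printing Implicit Defensive.

Import Order.TTheory GRing.Theory Num.Theory.
Import numFieldNormedType.Exports.

Local Open Scope classical_set_scope.
Local Open Scope ring_scope.

Arguments vle_trans {R s} [y x z].
Arguments vle_add2r {R s} z [x y].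
Arguments vle_scale {R s} [a x y].

(** * Order and norm estimates in a Banach lattice *)

Section VectorLattice.
Context {R : realType} {X : banachLatticeType R}.
Implicit Types (u v w x y z : X).

Lemma vle_join_l x y : x <=v vjoin x y.
Proof. by have := vle_refl (vjoin x y); rewrite vle_joinP => /andP[]. Qed.

Lemma vle_join_r x y : y <=v vjoin x y.
Proof. by have := vle_refl (vjoin x y); rewrite vle_joinP => /andP[]. Qed.

Lemma vmeet_le_l x y : vmeet x y <=v x.
Proof. by have := vle_refl (vmeet x y); rewrite vle_meetP => /andP[]. Qed.

Lemma vmeet_le_r x y : vmeet x y <=v y.
Proof. by have := vle_refl (vmeet x y); rewrite vle_meetP => /andP[]. Qed.

Lemma vle_add x y u v : x <=v y -> u <=v v -> x + u <=v y + v.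
Proof.
move=> xy uv; apply: (vle_trans (vle_add2r u xy)).
by rewrite ![y + _]addrC; exact: vle_add2r.
Qed.

Lemma vsubr_ge0 x y : (0 <=v y - x) = (x <=v y).
Proof.
apply/idP/idP => [/(vle_add2r x)|/(vle_add2r (- x))].
  by rewrite add0r subrK.
by rewrite subrr.
Qed.

Lemma vabs_leP x z : (vabs x <=v z) = (x <=v z) && (- x <=v z).
Proof. exact: vle_joinP. Qed.

Lemma vle_abs x : x <=v vabs x.
Proof. exact: vle_join_l. Qed.

Lemma vabsN x : vabs (- x) = vabs x.
Proof.
apply/vle_anti/andP; split; rewrite vabs_leP /vabs opprK;
  by rewrite vle_join_l vle_join_r.
Qed.

(** Adding the bounds [vabs x] of [x] and of [- x] shows that twice [vabs x] is nonnegative. *)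
Lemma vabs_ge0 x : 0 <=v vabs x.
Proof.
have := vle_add (vle_join_l x (- x)) (vle_join_r x (- x)).
rewrite subrr -mulr2n => /(@vle_scale _ _ 2^-1 _ _).
rewrite invr_ge0 ler0n => /(_ isT).
by rewrite scaler0 -[X in _ *: X]scaler_nat scalerA mulVf ?scale1r // pnatr_eq0.
Qed.

Lemma vabs_id x : 0 <=v x -> vabs x = x.
Proof.
move=> x0; apply/vle_anti; rewrite vle_abs andbT vabs_leP vle_refl /=.
by apply: (vle_trans _ x0); rewrite -vsubr_ge0 opprK add0r.
Qed.

Lemma vabs_le_ge0 x z : vabs x <=v z -> 0 <=v z.
Proof. exact: vle_trans (vabs_ge0 x). Qed.

Lemma vabsD x y u v : vabs x <=v u -> vabs y <=v v -> vabs (x + y) <=v u + v.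
Proof.
rewrite !vabs_leP => /andP[xu xu'] /andP[yv yv'].
by rewrite opprD !vle_add.
Qed.

Lemma vabs0 : vabs (0 : X) = 0.
Proof. by rewrite vabs_id ?vle_refl. Qed.

Lemma vabsB x y u v : vabs x <=v u -> vabs y <=v v -> vabs (x - y) <=v u + v.
Proof. by move=> xu yv; apply: vabsD; rewrite ?vabsN. Qed.

Lemma vabsZ (a : R) x z : vabs x <=v z -> vabs (a *: x) <=v `|a| *: z.
Proof.
rewrite !vabs_leP => /andP[xz xz'].
have [a0|/ltW a0] := ger0P a; first by rewrite -scalerN !vle_scale.
by rewrite -[a *: x]opprK -scaleNr opprK -scalerN !vle_scale ?oppr_ge0.
Qed.

Lemma vabs_sum (I : Type) (s : seq I) (f g : I -> X) :
  (forall i, vabs (f i) <=v g i) ->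
  vabs (\sum_(i <- s) f i) <=v \sum_(i <- s) g i.
Proof.
move=> fg; elim: s => [|i s IH]; first by rewrite !big_nil vabs0 vle_refl.
by rewrite !big_cons; exact: vabsD.
Qed.

(** Such a [z] is nonnegative, hence is its own absolute value, and monotonicity of the lattice norm
    applies. *)
Lemma norm_vabs_le x z : vabs x <=v z -> `|x| <= `|z|.
Proof.
move=> xz; apply: vle_norm; rewrite -!/(vabs _).
by rewrite [vabs z]vabs_id //; exact: vabs_le_ge0 xz.
Qed.

Lemma norm_vabs x : `|vabs x| = `|x|.
Proof.
by apply/le_anti/andP; split; apply: vle_norm;
  rewrite -!/(vabs _) [vabs (vabs _)]vabs_id ?vle_refl ?vabs_ge0.
Qed.

(* If [0 <= u], then the negative part of [l] is dominated by [|u - l|]. *)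
Lemma vge0_approx (l : X) :
  (forall eps : R, 0 < eps -> exists2 u, 0 <=v u & `|u - l| <= eps) -> 0 <=v l.
Proof.
move=> H; suff neg0 : vjoin (- l) 0 = 0.
  by have := vle_join_l (- l) 0; rewrite neg0 -(vsubr_ge0 (- l)) opprK add0r.
apply/eqP; rewrite -normr_eq0 -[_ == 0]negbK; apply/negP => /eqP nz.
have nl0 : 0 < `|vjoin (- l) 0|.
  by rewrite lt_neqAle normr_ge0 eq_sym andbT; apply/eqP.
have [u u0 ule] := H (`|vjoin (- l) 0| / 2) (divr_gt0 nl0 (ltr0Sn _ _)).
suff : `|vjoin (- l) 0| <= `|u - l| by move: ule nl0; lra.
rewrite -[leRHS]norm_vabs; apply: norm_vabs_le.
rewrite vabs_id ?vle_join_r // vle_joinP vabs_ge0 andbT.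
apply: vle_trans (vle_abs _).
by have := vle_add2r (- l) u0; rewrite add0r.
Qed.

Lemma vge0_cvg (u_ : nat -> X) (l : X) : u_ @ \oo --> l ->
  (\forall n \near \oo, 0 <=v u_ n) -> 0 <=v l.
Proof.
move=> ul u0; apply: vge0_approx => eps eps0.
have /cvgrPdist_le /(_ _ eps0) ul' := ul.
have [n [un0 ?]] := @filter_ex _ (\oo) _ _ (filterI u0 ul').
by exists (u_ n) => //; rewrite distrC.
Qed.

Lemma vabs_le_cvg (u_ : nat -> X) (l z : X) : u_ @ \oo --> l ->
  (\forall n \near \oo, vabs (u_ n) <=v z) -> vabs l <=v z.
Proof.
move=> ul uz; rewrite vabs_leP -!(vsubr_ge0 _ z); apply/andP; split.
  apply: (@vge0_cvg (fun n => z - u_ n)); first exact: cvgB (cvg_cst _) ul.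
  by apply: filterS uz => n; rewrite vabs_leP vsubr_ge0 => /andP[].
apply: (@vge0_cvg (fun n => z - - u_ n)).
  by apply: cvgB; [exact: cvg_cst|exact: cvgN].
by apply: filterS uz => n; rewrite vabs_leP vsubr_ge0 => /andP[].
Qed.

End VectorLattice.

(** * Sigma-order convergence through single dominating elements of small norm *)

Section SigmaOrderConvergence.
Context {R : realType} {X : banachLatticeType R}.
Implicit Types (u v : nat -> X) (x y z : X).

Lemma eq_sigma_order_cvg u v x :
  u =1 v -> sigma_order_cvg u x -> sigma_order_cvg v x.
Proof. by move=> /funext ->. Qed.

Fixpoint running_meet (y : nat -> X) (n : nat) : X :=
  if n is m.+1 then vmeet (running_meet y m) (y n) else y 0%N.

Lemma running_meet_le (y : nat -> X) n : running_meet y n <=v y n.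
Proof. by case: n => [|n] /=; [exact: vle_refl|exact: vmeet_le_r]. Qed.

Lemma running_meet_decr (y : nat -> X) m n :
  (m <= n)%N -> running_meet y n <=v running_meet y m.
Proof.
elim: n => [|n IH]; first by rewrite leqn0 => /eqP ->; exact: vle_refl.
rewrite leq_eqVlt => /predU1P[->|]; first exact: vle_refl.
by rewrite ltnS => /IH; apply: vle_trans; exact: vmeet_le_l.
Qed.

(** Each running meet involves only finitely many bounds, so they hold simultaneously for large
    [n]. *)
Lemma near_vle_running_meet (v y : nat -> X) :
  (forall i, \forall n \near \oo, v n <=v y i) ->
  forall i, \forall n \near \oo, v n <=v running_meet y i.
Proof.
move=> vy; elim=> [|i IH] /=; first exact: vy.
by apply: filterS2 IH (vy i.+1) => n; rewrite vle_meetP => -> ->.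
Qed.

(** Running meets turn bounds of norm at most [1 / (i + 1)] into one decreasing sequence. For a
    lower bound [w] of it, the nonnegative differences with [w] come arbitrarily close to [- w] in
    norm, so [- w] is nonnegative and the infimum is 0. *)
Lemma sigma_order_cvg_of_norm u x :
  (forall eps : R, 0 < eps ->
    exists2 z, `|z| <= eps & \forall n \near \oo, vabs (u n - x) <=v z) ->
  sigma_order_cvg u x.
Proof.
move=> H.
have /choice[y yP] : forall i : nat, exists z : X, `|z| <= i.+1%:R^-1 /\
    \forall n \near \oo, vabs (u n - x) <=v z.
  move=> i; have [|z zi uz] := H i.+1%:R^-1; last by exists z.
  by rewrite invr_gt0 ltr0n.
have uv := near_vle_running_meet (fun i => (yP i).2).
have v0 i : 0 <=v running_meet y i.
  by have [n /vabs_le_ge0] := @filter_ex _ (\oo) _ _ (uv i).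
exists (running_meet y) => //; split=> //; first exact: running_meet_decr.
move=> w wv; rewrite -vsubr_ge0 add0r; apply: vge0_approx => eps eps0.
(* This index [i] satisfies [1 / (i + 1) <= eps]. *)
exists (running_meet y (Num.truncn eps^-1) - w); first by rewrite vsubr_ge0.
rewrite opprK subrK; apply: le_trans (_ : `|y (Num.truncn eps^-1)| <= _).
  by apply: norm_vabs_le; rewrite vabs_id // running_meet_le.
apply: le_trans (yP _).1 _.
by rewrite invf_ple ?posrE ?ltr0n // ltW // truncnS_gt.
Qed.

Hypothesis hX : sigma_order_continuous X.

(** Sigma-order continuity makes the decreasing bounds tend to 0 in norm, so one of them serves for
    a given [eps]. Limit laws then become ordinary [eps] arguments. *)
Lemma sigma_order_cvgP u x : sigma_order_cvg u x <->
  forall eps : R, 0 < eps ->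
    exists2 z, `|z| <= eps & \forall n \near \oo, vabs (u n - x) <=v z.
Proof.
split; last exact: sigma_order_cvg_of_norm.
move=> [z /hX /cvgr0Pnorm_le z0 uz] eps /z0.
by move=> /(@filter_ex _ (\oo))[m zm]; exists (z m).
Qed.

Lemma sigma_order_cvg_norm_cvg u x : sigma_order_cvg u x -> norm_cvg u x.
Proof.
move=> /sigma_order_cvgP ux; apply/cvgrPdist_le => eps /ux[z zeps].
by apply: filterS => n /norm_vabs_le; rewrite distrC => /le_trans; exact.
Qed.

Lemma sigma_order_cvg_near_eq u x : (\forall n \near \oo, u n = x) ->
  sigma_order_cvg u x.
Proof.
move=> ux; apply/sigma_order_cvgP => eps eps0.
exists 0; first by rewrite normr0 ltW.
by apply: filterS ux => n ->; rewrite subrr vabs0 vle_refl.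
Qed.

Lemma sigma_order_cvgD u v x y : sigma_order_cvg u x -> sigma_order_cvg v y ->
  sigma_order_cvg (fun n => u n + v n) (x + y).
Proof.
move=> /sigma_order_cvgP ux /sigma_order_cvgP vy.
apply/sigma_order_cvgP => eps eps0.
have eps2 : 0 < eps / 2 by rewrite divr_gt0.
have [[z ze uz] [w we vw]] := (ux _ eps2, vy _ eps2).
exists (z + w); first by rewrite (splitr eps) (le_trans (ler_normD _ _)) ?lerD.
by apply: filterS2 uz vw => n uz vw; rewrite opprD addrACA vabsD.
Qed.

Lemma sigma_order_cvgZ (c : R) u x : sigma_order_cvg u x ->
  sigma_order_cvg (fun n => c *: u n) (c *: x).
Proof.
move=> /sigma_order_cvgP ux; apply/sigma_order_cvgP => eps eps0.
have c0 : 0 < `|c| + 1 by rewrite ltr_wpDl.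
have [z ze uz] := ux _ (divr_gt0 eps0 c0).
exists (`|c| *: z).
  rewrite normrZ normr_id (le_trans (ler_wpM2l _ ze)) // mulrA.
  by rewrite ler_pdivrMr // mulrC ler_pM2l // lerDl.
by apply: filterS uz => n uz; rewrite -scalerBr vabsZ.
Qed.

Lemma sigma_order_cvg_bounded u x : sigma_order_cvg u x ->
  exists z, forall n, vabs (u n) <=v z.
Proof.
move=> /sigma_order_cvgP/(_ 1 ltr01)[z _ [N _ uz]].
(* [z + vabs x] dominates the terms from [N] on; the sum absorbs the earlier ones. *)
exists (z + vabs x + \sum_(i < N) vabs (u i)) => n.
have sum0 (P : pred 'I_N) : 0 <=v \sum_(i < N | P i) vabs (u i).
  elim/big_ind: _ => [|a b a0 b0|i _]; rewrite ?vle_refl ?vabs_ge0 //.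
  by rewrite -[0]addr0 vle_add.
have [nN|Nn] := ltnP n N; last first.
  rewrite -[vabs _]addr0 vle_add // -[u n](subrK x) vabsD ?vle_refl //.
  exact: uz.
have zx : 0 <=v z + vabs x.
  by rewrite -[0]addr0 vle_add ?vabs_ge0 // (vabs_le_ge0 (uz N (leqnn N))).
rewrite -[vabs _]add0r vle_add // (bigD1 (Ordinal nN)) //=.
by rewrite -[X in X <=v _]addr0 vle_add ?vle_refl.
Qed.

End SigmaOrderConvergence.

(** * Expansions whose partial sums are dominated in the lattice *)

Section DominatedExpansion.
Context {R : realType} {X : banachLatticeType R} (e : nat -> X).
Implicit Types (a b : nat -> R) (x y z : X).

Hypothesis hX : sigma_order_continuous X.
Hypothesis he : sigma_order_basis e.

Local Notation partial a := (series (fun n => a n *: e n)).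

(* The norm inf {|z| : dominated x z} replaces the usual sup of the norms of
   the partial sums; taking the bound inside the lattice is what makes it
   complete. *)
Definition dominated x z := exists2 a : nat -> R,
  expansion sigma_order_cvg e x a & forall m, vabs (partial a m) <=v z.

Lemma partialD a b m :
  partial (fun n => a n + b n) m = partial a m + partial b m.
Proof.
by rewrite /series /= -big_split; apply: eq_bigr => i _; rewrite scalerDl.
Qed.

Lemma partialZ (c : R) a m : partial (fun n => c * a n) m = c *: partial a m.
Proof.
by rewrite /series /= scaler_sumr; apply: eq_bigr => i _; rewrite scalerA.
Qed.

Lemma expansion0 : expansion sigma_order_cvg e 0 (fun=> 0).
Proof.
apply: (sigma_order_cvg_near_eq hX); apply: nearW => n.
by rewrite /series /= big1 // => i _; rewrite scale0r.
Qed.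

Lemma expansionD a b x y :
  expansion sigma_order_cvg e x a -> expansion sigma_order_cvg e y b ->
  expansion sigma_order_cvg e (x + y) (fun n => a n + b n).
Proof.
move=> xa yb; apply: (eq_sigma_order_cvg (fun m => esym (partialD a b m))).
exact: sigma_order_cvgD.
Qed.

Lemma expansionZ (c : R) a x : expansion sigma_order_cvg e x a ->
  expansion sigma_order_cvg e (c *: x) (fun n => c * a n).
Proof.
move=> xa; apply: (eq_sigma_order_cvg (fun m => esym (partialZ c a m))).
exact: sigma_order_cvgZ.
Qed.

Lemma expansion_uniq a b x : expansion sigma_order_cvg e x a ->
  expansion sigma_order_cvg e x b -> a = b.
Proof. by have [c [_ cuniq]] := he x => /cuniq <- /cuniq <-. Qed.

Lemma expansion_sum (I : Type) (s : seq I) (a : I -> nat -> R) (x : I -> X) :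
  (forall i, expansion sigma_order_cvg e (x i) (a i)) ->
  expansion sigma_order_cvg e (\sum_(i <- s) x i)
    (fun n => \sum_(i <- s) a i n).
Proof.
move=> xa; elim: s => [|i s IH].
  rewrite big_nil (_ : (fun n => _) = fun=> 0); first exact: expansion0.
  by apply/funext => n; rewrite big_nil.
rewrite big_cons (_ : (fun n => _) = fun n => a i n + \sum_(j <- s) a j n).
  exact: expansionD.
by apply/funext => n; rewrite big_cons.
Qed.

Lemma partial_sum (I : Type) (s : seq I) (a : I -> nat -> R) m :
  partial (fun n => \sum_(i <- s) a i n) m = \sum_(i <- s) partial (a i) m.
Proof.
rewrite /series /= exchange_big; apply: eq_bigr => n _.
by rewrite scaler_suml.
Qed.

(** Were [e k] zero, the indicator of [k] would be a second expansion of 0. *)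
Lemma basis_neq0 k : e k != 0.
Proof.
apply/eqP => ek0; have := expansion0.
have : expansion sigma_order_cvg e 0 (fun n => (n == k)%:R).
  apply: (sigma_order_cvg_near_eq hX); apply: nearW => n.
  rewrite /series /= big1 // => i _.
  by have [->|] := eqVneq i k; rewrite ?ek0 ?scaler0 ?scale0r.
move=> /expansion_uniq/[apply] /(congr1 (@^~ k)) /eqP.
by rewrite eqxx oner_eq0.
Qed.

Lemma dominatedD x y z w :
  dominated x z -> dominated y w -> dominated (x + y) (z + w).
Proof.
move=> [a xa az] [b yb bw].
exists (fun n => a n + b n); first exact: expansionD.
by move=> m; rewrite partialD vabsD.
Qed.

Lemma dominatedZ (c : R) x z : dominated x z -> dominated (c *: x) (`|c| *: z).
Proof.
move=> [a xa az]; exists (fun n => c * a n); first exact: expansionZ.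
by move=> m; rewrite partialZ vabsZ.
Qed.

Lemma dominatedB x y z w :
  dominated x z -> dominated y w -> dominated (x - y) (z + w).
Proof.
move=> xz /(dominatedZ (-1)); rewrite scaleN1r normrN1 scale1r.
exact: dominatedD.
Qed.

Lemma dominated_exists x : exists z, dominated x z.
Proof.
have [a [xa _]] := he x.
by have [z az] := sigma_order_cvg_bounded hX xa; exists z; exists a.
Qed.

Lemma dominated0 : dominated 0 0.
Proof.
exists (fun=> 0); first exact: expansion0.
move=> m; rewrite /series /= big1 ?vabs0 ?vle_refl // => i _.
by rewrite scale0r.
Qed.

(** The term [a n *: e n] is a difference of two consecutive partial sums, each of norm at most that
    of [z]. *)
Lemma norm_coef_le a z n : (forall m, vabs (partial a m) <=v z) ->
  `|a n| <= 2 / `|e n| * `|z|.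
Proof.
move=> az; have en0 : 0 < `|e n| by rewrite normr_gt0 basis_neq0.
rewrite mulrAC ler_pdivlMr // -normrZ -(seriesSB (fun n => a n *: e n)).
rewrite (le_trans (ler_normB _ _)) // mulr_natl mulr2n.
by rewrite lerD // norm_vabs_le.
Qed.

(** For nonnegative terms a finite block lies below every longer block from [K]; the closed positive
    cone lets the longer block grow to the whole tail. *)
Lemma vle_series_lim (z : nat -> X) (Z : X) : (forall k, 0 <=v z k) ->
  series z @ \oo --> Z -> forall K K', (K <= K')%N ->
  \sum_(K <= k < K') z k <=v Z - series z K.
Proof.
move=> z0 zZ K K' KK'; rewrite -vsubr_ge0.
apply: (@vge0_cvg _ _
  (fun n => series z n - series z K - \sum_(K <= k < K') z k)).
  by apply: cvgB; [apply: cvgB => //|]; exact: cvg_cst.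
near=> n; have K'n : (K' <= n)%N by near: n; exact: nbhs_infty_ge.
rewrite sub_series_geq ?(leq_trans KK') // (big_cat_nat KK' K'n) /=.
rewrite [X in X - _]addrC addrK.
elim/big_ind: _ => [|x y x0 y0|i _]; rewrite ?vle_refl //.
by rewrite -[0]addr0 vle_add.
Unshelve. all: by end_near. Qed.

(* Completeness of the norm described above [dominated]: the coefficients are
   summed termwise, the tails of [z] bound the error, and
   [sigma_order_cvg_of_norm] turns these norm-small bounds into order
   convergence. *)
Lemma dominated_series (u z : nat -> X) x :
  (forall k, dominated (u k) (z k)) -> cvgn [normed series z] ->
  series u @ \oo --> x -> dominated x (limn (series z)).
Proof.
move=> uz cz ux.
have /choice[a aP] : forall k, exists a : nat -> R,
    expansion sigma_order_cvg e (u k) a /\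
    forall m, vabs (partial a m) <=v z k.
  by move=> k; have [a] := uz k; exists a.
have z0 k : 0 <=v z k := vabs_le_ge0 ((aP k).2 0%N).
have zZ : series z @ \oo --> limn (series z) := normed_cvg cz.
set Z := limn _ in zZ *.
have ca n : cvgn (series (fun k => a k n)).
  apply: normed_cvg.
  apply: (@series_le_cvg _ _ (fun k => (2 / `|e n|) *: `|z k|)) => [k|k|k|].
  - exact: normr_ge0.
  - by rewrite mulr_ge0 // divr_ge0.
  - exact: norm_coef_le (aP k).2.
  - exact: (is_cvg_seriesZ (k := 2 / `|e n|) cz).
pose b n := limn (series (fun k => a k n)).
have cb m : (fun K => \sum_(0 <= k < K) partial (a k) m) @ \oo --> partial b m.
  under eq_fun do rewrite -partial_sum.
  apply: cvg_big => [|n _]; last by apply: cvgZr_tmp; exact: ca.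
  exact: add_continuous.
(* With [m] fixed, [K'] goes to infinity in a bound on the terms [K] to [K']. The resulting bound
   does not depend on [m]. *)
have tail m K : vabs (partial b m - \sum_(0 <= k < K) partial (a k) m)
    <=v Z - series z K.
  apply: (@vabs_le_cvg _ _ (fun K' => \sum_(0 <= k < K') partial (a k) m -
                                      \sum_(0 <= k < K) partial (a k) m)).
    by apply: cvgB; [exact: cb|exact: cvg_cst].
  near=> K'; have KK' : (K <= K')%N by near: K'; exact: nbhs_infty_ge.
  rewrite (big_cat_nat (leq0n _) KK') /= [X in X - _]addrC addrK.
  apply: vle_trans (vle_series_lim z0 zZ KK').
  by apply: vabs_sum => k; exact: (aP k).2.
exists b; last first.
  (* At [K = 0] the tail bound is the domination by [Z] itself. *)
  move=> m; have := tail m 0%N.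
  by rewrite big_geq // subr0 [series z 0%N]big_geq // subr0.
apply: sigma_order_cvg_of_norm => eps eps0.
(* Three errors share [eps]: replacing [b] by the first [K] expansions, convergence of their finite
   sum, and the remainder of [series u]. *)
have eps3 : 0 < eps / 3 by rewrite divr_gt0.
have [K [ZK xK]] : exists K, `|Z - series z K| <= eps / 3 /\
    `|x - series u K| <= eps / 3.
  have /cvgrPdist_le/(_ _ eps3) ZK := zZ.
  have /cvgrPdist_le/(_ _ eps3) xK := ux.
  exact: (@filter_ex _ (\oo) _ _ (filterI ZK xK)).
have /(sigma_order_cvgP hX)/(_ _ eps3)[w we uw] :=
  expansion_sum (index_iota 0 K) (fun k => (aP k).1).
exists (Z - series z K + w + vabs (x - series u K)).
  rewrite (le_trans (ler_normD _ _)) // norm_vabs.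
  have := ler_normD (Z - series z K) w; move: ZK we xK; lra.
apply: filterS uw => m; rewrite partial_sum => uw.
rewrite -[_ - x](_ : partial b m - \sum_(0 <= k < K) partial (a k) m +
  (\sum_(0 <= k < K) partial (a k) m - series u K) - (x - series u K) = _).
  by rewrite vabsB ?vle_refl // vabsD.
by rewrite addrA subrK opprB addrA subrK.
Unshelve. all: by end_near. Qed.

(** * Baire category and successive approximation *)

Lemma dominated_somewhere_dense : exists (n : nat) (x0 : X) (r : R), 0 < r /\
  forall y (eps : R), `|x0 - y| < r -> 0 < eps ->
  exists u z, [/\ dominated u z, `|z| <= n%:R & `|y - u| < eps].
Proof.
pose A n := [set u | exists2 z, dominated u z & `|z| <= n%:R].
(* Every element is dominated by some [z], so the sets [A n] cover the space. If all complements of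
   their closures were dense, Baire would yield a point outside every [A n]. *)
have [n nA] : exists n, ~ dense (~` closure (A n)).
  apply/existsNP => Adense.
  have /(_ setT)[||x [_ xA]] : dense (\bigcap_n ~` closure (A n)).
  - by apply: Baire => n; split=> //; exact/closed_openC/closed_closure.
  - by exists 0.
  - exact: openT.
  have [z xz] := dominated_exists x.
  apply: (xA (Num.truncn `|z|).+1 I); apply: subset_closure.
  by exists z => //; rewrite ltW // truncnS_gt.
have [V [[x0 [oV Vx0]] VA]] := denseNE nA.
have /nbhs_ballP[r /= r0 rV] := open_nbhs_nbhs (conj oV Vx0).
exists n, x0, r; split => // y eps yr eps0.
have : closure (A n) y.
  apply: contrapT => yA; suff : set0 y by [].
  by rewrite -VA; split => //; apply: rV; rewrite -ball_normE.
move=> /(_ _ (nbhsx_ballx y eps eps0))[u [[z uz zn] yu]].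
by exists u, z; split => //; rewrite -ball_normE in yu.
Qed.

(** Shrink [y] to [t *: y] of norm [r / 2], approximate [x0 + t *: y] and [x0] within [r / 8],
    subtract, and rescale by [t^-1 = 2 * |y| / r]. The error is at most [|y| / 2], and the two
    bounds [n] add up to [4 * n / r * |y|]. *)
Lemma dominated_half_approx : exists2 C : R, 0 <= C & forall y,
  exists u z, [/\ dominated u z, `|z| <= C * `|y| & `|y - u| <= `|y| / 2].
Proof.
have [n [x0 [r [r0 H]]]] := dominated_somewhere_dense.
exists (4 * n%:R / r); first by rewrite divr_ge0 ?mulr_ge0 // ltW.
move=> y; have [->|y0] := eqVneq y 0.
  exists 0, 0; rewrite subr0 !normr0 mulr0 mul0r.
  by split=> //; exact: dominated0.
have ny : 0 < `|y| by rewrite normr_gt0.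
pose t := r / (2 * `|y|); have t0 : 0 < t by rewrite divr_gt0 ?mulr_gt0.
have tE : t^-1 = 2 * `|y| / r by rewrite invf_div.
have nty : `|t *: y| < r.
  rewrite normrZ gtr0_norm // /t invfM mulrA divfK ?gt_eqF //.
  by rewrite ltr_pdivrMr // ltr_pMr // ltr1n.
have r8 : 0 < r / 8 by rewrite divr_gt0.
have [||u [z [uz zn yu]]] := H (x0 + t *: y) (r / 8) => //.
  by rewrite opprD addrA subrr add0r normrN.
have [||v [w [vw wn xv]]] := H x0 (r / 8) => //; first by rewrite subrr normr0.
exists (t^-1 *: (u - v)), (`|t^-1| *: (z + w)); split.
- exact/dominatedZ/dominatedB.
- rewrite normrZ normr_id gtr0_norm ?invr_gt0 // tE.
  have -> : 4 * n%:R / r * `|y| = 2 * `|y| / r * (n%:R + n%:R) by ring.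
  rewrite ler_wpM2l ?divr_ge0 ?mulr_ge0 ?(ltW r0) //.
  by rewrite (le_trans (ler_normD _ _)) // lerD.
- rewrite -[y in y - _](scalerK (lt0r_neq0 t0)) -scalerBr normrZ.
  rewrite gtr0_norm ?invr_gt0 // tE.
  have -> : `|y| / 2 = 2 * `|y| / r * (r / 4) by field; rewrite gt_eqF.
  rewrite ler_wpM2l ?divr_ge0 ?mulr_ge0 ?(ltW r0) //.
  have -> : t *: y - (u - v) = (x0 + t *: y - u) - (x0 - v).
    by rewrite !opprB [RHS]addrC -[x0 + _ - u]addrA [RHS]addrA subrK addrCA.
  rewrite (le_trans (ler_normB _ _)) //.
  by move: yu xv; lra.
Qed.

(** As in the open mapping theorem, halving the residual repeatedly writes [x] as a series of
    dominated elements. The norms of their bounds are at most [C * |x| / 2 ^ k], with sum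
    [2 * C * |x|]. *)
Lemma dominated_bound : exists C : R, forall x,
  exists2 z, dominated x z & `|z| <= C * `|x|.
Proof.
have [C C0 H] := dominated_half_approx.
have /choice[uz uzP] : forall y, exists p : X * X,
    [/\ dominated p.1 p.2, `|p.2| <= C * `|y| & `|y - p.1| <= `|y| / 2].
  by move=> y; have [u [z ?]] := H y; exists (u, z).
exists (C * 2) => x.
pose r k := iter k (fun y => y - (uz y).1) x.
have rle k : `|r k| <= geometric `|x| 2^-1 k.
  elim: k => [|k IH]; first by rewrite /= expr0 mulr1.
  have [_ _ /le_trans] := uzP (r k); apply.
  by rewrite /= exprSr mulrA ler_pM2r ?invr_gt0.
have half1 : `|2^-1 : R| < 1 by rewrite gtr0_norm ?invr_gt0 // invf_lt1 ?ltr1n.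
have ru : series (fun k => (uz (r k)).1) @ \oo --> x.
  (* The sum telescopes, since each approximant is the difference of consecutive residuals. *)
  have -> : series (fun k => (uz (r k)).1) = fun k => x - r k.
    apply/funext; elim=> [|k IH]; first by rewrite /series /= big_geq // subrr.
    by rewrite seriesSr IH /= opprB -addrA [- _ + _]addrC.
  rewrite -[X in _ --> X]subr0; apply: cvgB; first exact: cvg_cst.
  apply: norm_cvg0.
  apply: (@squeeze_cvgr _ _ _ _ (fun=> 0) (geometric `|x| 2^-1)).
  - by apply: nearW => k; rewrite normr_ge0 rle.
  - exact: cvg_cst.
  - exact: cvg_geometric.
have zle k : `|(uz (r k)).2| <= geometric (C * `|x|) 2^-1 k.
  have [_ /le_trans + _] := uzP (r k); apply.
  by rewrite /= -mulrA ler_wpM2l // rle.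
have gcvg := is_cvg_geometric_series (a := C * `|x|) half1.
have zc : cvgn [normed series (fun k => (uz (r k)).2)].
  apply: (series_le_cvg _ _ zle gcvg) => // k.
  exact: le_trans (normr_ge0 _) (zle k).
exists (limn (series (fun k => (uz (r k)).2))).
  apply: dominated_series ru => // k.
  by have [] := uzP (r k).
rewrite (le_trans (lim_series_norm zc)) //.
rewrite (le_trans (lim_series_le zc gcvg zle)) //.
rewrite (cvg_lim (@Rhausdorff R) (cvg_geometric_series half1)).
have -> : 1 - 2^-1 = 2^-1 :> R by lra.
by rewrite invrK mulrAC.
Qed.

(** * Uniqueness of norm expansions *)

Lemma norm_expansion_cvg0 (c : nat -> R) : norm_cvg (partial c) 0 ->
  c = fun=> 0.
Proof.
move=> c0; have [C CP] := dominated_bound.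
apply/funext => k; apply/eqP; rewrite -normr_le0.
have ek0 : 0 < `|e k| by rewrite normr_gt0 basis_neq0.
have cle m : (k < m)%N -> `|c k| <= 2 / `|e k| * (C * `|partial c m|).
  move=> km; have [z [a xa az] zle] := CP (partial c m).
  (* The partial sums of the truncation are constant from [m] on, so it is the order expansion of
     [partial c m]. Hence [c k] is bounded by a constant multiple of the norm of [partial c m],
     which tends to 0. *)
  pose c' n := if (n < m)%N then c n else 0.
  suff ac' : a = c'.
    rewrite (_ : c k = a k); last by rewrite ac' /c' km.
    by rewrite (le_trans (norm_coef_le _ az)) // ler_wpM2l // divr_ge0.
  apply: expansion_uniq xa _; apply: (sigma_order_cvg_near_eq hX).
  near=> n; have mn : (m <= n)%N by near: n; exact: nbhs_infty_ge.
  rewrite /series /= (big_cat_nat (leq0n m) mn) /= [X in _ + X]big_nat_cond.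
  rewrite [X in _ + X]big1 ?addr0 => [|i /andP[/andP[mi _] _]]; last first.
    by rewrite /c' ltnNge mi scale0r.
  by apply: eq_big_nat => i /andP[_ im]; rewrite /c' im.
apply/ler_addgt0Pl => eps eps0; rewrite addr0.
have cC : (fun m => 2 / `|e k| * (C * `|partial c m|)) @ \oo --> (0 : R).
  rewrite -[X in _ --> X](mulr0 (2 / `|e k|)) -(mulr0 C) -(normr0 X).
  by apply: cvgMl_tmp; apply: cvgMl_tmp; exact: cvg_norm.
have /cvgr0_norm_le/(_ _ eps0)[N _ HN] := cC.
rewrite (le_trans (cle (maxn N k.+1) _)) ?leq_maxr //.
by rewrite (le_trans (ler_norm _)) // HN //= leq_maxl.
Unshelve. all: by end_near. Qed.

(** A norm expansion of [x] minus its order expansion is a norm expansion of 0, hence zero. Equality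
    of the predicates transfers both the basis property and the functionals by rewriting. *)
Lemma norm_expansionE : expansion norm_cvg e = expansion sigma_order_cvg e.
Proof.
apply/funext => x; apply/funext => b; apply/propext; split; last first.
  exact: sigma_order_cvg_norm_cvg.
move=> xb; have [a [xa _]] := he x.
suff -> : b = a by [].
have ba0 : norm_cvg (partial (fun n => b n + -1 * a n)) 0.
  have -> : partial (fun n => b n + -1 * a n) = partial b \- partial a.
    by apply/funext => n /=; rewrite partialD partialZ scaleN1r.
  by rewrite -(subrr x); apply: cvgB => //; exact: sigma_order_cvg_norm_cvg xa.
apply/funext => n; have /(congr1 (@^~ n))/eqP := norm_expansion_cvg0 ba0.
by rewrite mulN1r subr_eq0 => /eqP.
Qed.

End DominatedExpansion.

Theorem corollary1p9 (R : realType) (X : banachLatticeType R) (e : nat -> X)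
  (hX : sigma_order_continuous X) (he : sigma_order_basis e) :
  schauder_basis e /\
  (forall k : nat, biorthogonal norm_cvg e k = biorthogonal sigma_order_cvg e k).
Proof.
have nE := norm_expansionE hX he.
by split=> [|k]; rewrite /schauder_basis /is_basis /biorthogonal nE.
Qed.
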